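(* Let $\pi_0\in\Pi_{\mathrm{all}}$ and let $F$ be a Legendre function whose domain is a closed convex set $\mathcal{K}\supseteq\mathbb{R}^d_{\ge0}$. Suppose $F$ is either (1) quadratic: $F(p)=\frac12p^\top Ap+b^\top p$ with $A\succ0$, or (2) separable: $F(p)=\sum_{i=1}^df(p_i)$ for a one-dimensional convex function $f$. Let $\overline\pi$ be the minimizer of $\pi\mapsto\mathbb{E}_{x\sim\mathcal{D}_{\mathcal{X}}}[\mathsf{B}_F(\pi(x)\parallel\pi_0(x))]$ over the linear subspace $\mathcal{C}^{\dagger\dagger}_{\mathrm{coh}}$. Then $\overline\pi\in\mathcal{C}^\dagger_{\mathrm{coh}}$.
   Context: $\mathcal{X},\mathcal{Y}$ finite, $d=|\mathcal{Y}|$; $\Pi_{\mathrm{all}}=\Delta(\mathcal{Y})^{\mathcal{X}}$, $\Pi^\dagger_{\mathrm{all}}=(\mathbb{R}^d_{+})^{\mathcal{X}}$. $\mathcal{D}_{\mathcal{X}}$ a full-support distribution on $\mathcal{X}$; $\Phi\colon\mathcal{X}\to\mathcal{X}$ an involution. $\mathcal{C}^{\dagger\dagger}_{\mathrm{coh}}=\{\pi\colon\mathcal{X}\to\mathbb{R}^d:\pi(x)=\pi(\Phi(x))\ \forall x\}$ and $\mathcal{C}^\dagger_{\mathrm{coh}}=\mathcal{C}^{\dagger\dagger}_{\mathrm{coh}}\cap\Pi^\dagger_{\mathrm{all}}$. $\mathsf{B}_F(p\parallel q)=F(p)-F(q)-\langle\nabla F(q),p-q\rangle$, extended to boundary points as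 needed. A Legendre function is proper, closed, convex, differentiable on the interior $\Omega$ of its domain, with $\nabla F\colon\Omega\to\mathrm{int}(\mathrm{dom}F^* )$ a bijection. *)

(* Defs.v *)
From HB Require Import structures.
From mathcomp Require Import all_boot all_order all_algebra.
From mathcomp Require Import all_classical all_reals all_analysis.
Set Implicit Arguments. Unset Strict Implicit. Unset Printing Implicit Defensive.
Import Order.TTheory GRing.Theory Num.Theory.
Import numFieldNormedType.Exports.
Local Open Scope classical_set_scope.
Local Open Scope ring_scope.

Section Defs.
Variables (R : realType) (d : nat).

(* Vectors in R^d are row vectors 'rV[R]_d (Y is identified with 'I_d). *)
Definition dotv (u v : 'rV[R]_d) : R := \sum_(i < d) u 0 i * v 0 i.

Definition edom (F : 'rV[R]_d -> \bar R) : set 'rV[R]_d :=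
  [set p | (F p < +oo)%E].

Definition proper_fun (F : 'rV[R]_d -> \bar R) : Prop :=
  (forall p, F p != -oo%E) /\ (exists p, (F p < +oo)%E).

Definition closed_fun (F : 'rV[R]_d -> \bar R) : Prop :=
  closed [set pr : 'rV[R]_d * R | (F pr.1 <= pr.2%:E)%E].

Definition convex_fun (F : 'rV[R]_d -> \bar R) : Prop :=
  forall p q (t : R), (F p < +oo)%E -> (F q < +oo)%E -> 0 <= t -> t <= 1 ->
    (F (t *: p + (1 - t) *: q)%R <= t%:E * F p + (1 - t)%R%:E * F q)%E.

Definition grad (F : 'rV[R]_d -> \bar R) (q : 'rV[R]_d) : 'rV[R]_d :=
  \row_i ('d (fun p => fine (F p)) q (delta_mx 0 i : 'rV[R]_d)).

Definition conjugate (F : 'rV[R]_d -> \bar R) (y : 'rV[R]_d) : \bar R :=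
  ereal_sup [set ((dotv y p)%:E - F p)%E | p in [set: 'rV[R]_d]].

Definition legendre (F : 'rV[R]_d -> \bar R) : Prop :=
  [/\ proper_fun F, closed_fun F, convex_fun F &
      [/\ (forall q, interior (edom F) q -> differentiable (fun p => fine (F p)) q),
      (forall q1 q2, interior (edom F) q1 -> interior (edom F) q2 ->
          grad F q1 = grad F q2 -> q1 = q2) &
      grad F @` interior (edom F) = interior (edom (conjugate F))]].

(* one-sided directional derivative of a convex function:
   F'(q; v) = lim_{t -> 0+} (F(q + t v) - F q) / t = inf_{t > 0} (...) *)
Definition dirder (F : 'rV[R]_d -> \bar R) (q v : 'rV[R]_d) : \bar R :=
  ereal_inf [set ((F (q + t *: v)%R - F q) * (t^-1)%:E)%E | t in [set t : R | 0 < t]].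

Definition bregman (F : 'rV[R]_d -> \bar R) (p q : 'rV[R]_d) : \bar R :=
  if `[< interior (edom F) q >] then
    (F p - (fine (F q) + dotv (grad F q) (p - q)%R)%:E)%E
  else if F p == +oo%E then +oo%E
  else (F p - F q - dirder F q (p - q)%R)%E.

Definition quadratic_fun (F : 'rV[R]_d -> \bar R) : Prop :=
  exists (A : 'M[R]_d) (b : 'rV[R]_d),
    [/\ A^T = A,
        (forall v : 'rV[R]_d, v != 0 -> 0 < (v *m A *m v^T) 0 0) &
        (forall p, edom F p -> F p = (2^-1 * (p *m A *m p^T) 0 0 + dotv b p)%:E)].

Definition convex_fun1 (f : R -> \bar R) : Prop :=
  forall a b (t : R), (f a < +oo)%E -> (f b < +oo)%E -> 0 <= t -> t <= 1 ->
    (f (t * a + (1 - t) * b)%R <= t%:E * f a + (1 - t)%R%:E * f b)%E.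

Definition separable_fun (F : 'rV[R]_d -> \bar R) : Prop :=
  exists f : R -> \bar R, convex_fun1 f /\
    (forall p, F p = (\sum_(i < d) f (p ord0 i))%E).

End Defs.

Section Objective.
Variables (R : realType) (d : nat) (X : finType).

Definition exp_bregman (D : X -> R) (F : 'rV[R]_d -> \bar R)
    (pi pi0 : X -> 'rV[R]_d) : \bar R :=
  (\sum_(x : X) (D x)%:E * bregman F (pi x) (pi0 x))%E.

Definition coherent (Phi : X -> X) (pi : X -> 'rV[R]_d) : Prop :=
  forall x, pi x = pi (Phi x).

End Objective.

(* Main.v *)
(** Quadratic case: such an [F] has an everywhere finite conjugate, so its
    gradient, [q |-> q A + b] on the interior of the domain, is onto and the
    domain is the whole space. Hence the Bregman divergence is half the
    squared [A]-norm, and the minimizer is the [D]-weighted average of [pi0]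
    over each orbit of [Phi], which is nonnegative.

    Separable case: a minimizer has finite objective, because the zero policy
    does. If it has a negative coordinate, the domain contains a neighbourhood
    of the orthant, and replacing every negative coordinate by 0 preserves
    coherence and strictly decreases the objective: with [r] the positive part
    of [p], [F p > F r + <grad F r, p - r>], while
    [<grad F r, p - r> >= <grad F q, p - r>] for [q >= 0], as the partial
    derivatives of a separable convex function are monotone. *)
Require Import Defs.
From HB Require Import structures.
From mathcomp Require Import all_boot all_order all_algebra.
From mathcomp Require Import all_classical all_reals all_analysis.
From mathcomp Require Import ring lra.
Set Implicit Arguments.
Unset Strict Implicit.
Unset Printing Implicit Defensive.
Import Order.TTheory GRing.Theory Num.Theory.
Import numFieldNormedType.Exports.
Local Open Scope classical_set_scope.
Local Open Scope ring_scope.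

(** * Inner products, gradients and one-sided difference quotients *)

Lemma dotvDr (R : realType) (d : nat) (u v w : 'rV[R]_d) :
  dotv u (v + w) = dotv u v + dotv u w.
Proof.
by rewrite /dotv -big_split; apply: eq_bigr => i _; rewrite mxE mulrDr.
Qed.

Lemma dotvZr (R : realType) (d : nat) (a : R) (u v : 'rV[R]_d) :
  dotv u (a *: v) = a * dotv u v.
Proof.
by rewrite /dotv big_distrr; apply: eq_bigr => i _; rewrite mxE mulrCA.
Qed.

Lemma dotvNr (R : realType) (d : nat) (u v : 'rV[R]_d) :
  dotv u (- v) = - dotv u v.
Proof. by rewrite -scaleN1r dotvZr mulN1r. Qed.

Lemma dotv_delta (R : realType) (d : nat) (u : 'rV[R]_d) (i : 'I_d) :
  dotv u (delta_mx 0 i) = u 0 i.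
Proof.
rewrite /dotv (bigD1 i) //= big1 ?addr0 ?mxE ?eqxx ?mulr1 // => j ji.
by rewrite mxE (negbTE ji) mulr0.
Qed.

Lemma dotv_grad (R : realType) (d : nat) (F : 'rV[R]_d -> \bar R)
    (q v : 'rV[R]_d) :
  differentiable (fun p => fine (F p)) q ->
  dotv (grad F q) v = 'd (fun p => fine (F p)) q v.
Proof.
move=> dF; rewrite [in RHS](row_sum_delta v) linear_sum /dotv.
by apply: eq_bigr => i _; rewrite linearZ mxE mulrC.
Qed.

(** The limit is taken from the right because the bounds on increments used below are available for
    small [t > 0]. *)
Lemma diff_quotient_cvg (R : realType) (d : nat) (g : 'rV[R]_d -> R)
    (q v : 'rV[R]_d) : differentiable g q ->
  t^-1 * (g (q + t *: v) - g q) @[t --> 0^'+] --> ('d g q v : R).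
Proof.
move=> dg; apply: cvg_dnbhs_at_right; rewrite -deriveE //.
have := @diff_derivable _ _ _ _ _ v dg.
rewrite /derivable /derive => /cvg_ex[l hl].
rewrite (cvg_lim _ hl)//; apply: cvg_trans hl; apply: near_eq_cvg.
by apply: nearW => t /=; rewrite [q + _]addrC.
Qed.

Lemma diff_ge (R : realType) (d : nat) (g : 'rV[R]_d -> R)
    (q v : 'rV[R]_d) (c : R) : differentiable g q ->
  (\forall t \near 0^'+, t * c <= g (q + t *: v) - g q) -> c <= 'd g q v.
Proof.
move=> dg H; have hc := diff_quotient_cvg (v := v) dg.
rewrite -(cvg_lim (@Rhausdorff R) hc); apply: limr_ge.
  by apply/cvg_ex; eexists; exact: hc.
near=> t; have t0 : 0 < t by near: t; exact: nbhs_right_gt.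
by rewrite ler_pdivlMl //; near: t.
Unshelve. all: by end_near. Qed.

Lemma diff_le (R : realType) (d : nat) (g : 'rV[R]_d -> R)
    (q v : 'rV[R]_d) (c : R) : differentiable g q ->
  (\forall t \near 0^'+, g (q + t *: v) - g q <= t * c) -> 'd g q v <= c.
Proof.
move=> dg H; have hc := diff_quotient_cvg (v := v) dg.
rewrite -(cvg_lim (@Rhausdorff R) hc); apply: limr_le.
  by apply/cvg_ex; eexists; exact: hc.
near=> t; have t0 : 0 < t by near: t; exact: nbhs_right_gt.
by rewrite ler_pdivrMl //; near: t.
Unshelve. all: by end_near. Qed.

Lemma near_right_segment (R : realType) (d : nat) (A : set 'rV[R]_d)
    (q v : 'rV[R]_d) :
  interior A q -> \forall t \near (0 : R)^'+, A (q + t *: v).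
Proof.
move=> Aq; have h : (fun t : R => q + t *: v) @ (0 : R)^'+ --> q.
  apply: cvg_at_right_filter; rewrite -[X in _ --> X](addr0 q) -(scale0r v).
  by apply: cvgD; [exact: cvg_cst|apply: cvgZr_tmp; exact: cvg_id].
exact: h.
Qed.

(** * Gradient inequalities for convex and Legendre functions *)

Lemma edom_fin_num (R : realType) (d : nat) (F : 'rV[R]_d -> \bar R)
    (p : 'rV[R]_d) : proper_fun F -> edom F p -> F p \is a fin_num.
Proof. by case=> FN _ Fp; rewrite fin_numE FN lt_eqF. Qed.

Lemma convex_fine (R : realType) (d : nat) (F : 'rV[R]_d -> \bar R)
    (p q : 'rV[R]_d) (t : R) : proper_fun F -> convex_fun F ->
  edom F p -> edom F q -> 0 <= t -> t <= 1 ->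
  edom F (t *: p + (1 - t) *: q) /\
  fine (F (t *: p + (1 - t) *: q)) <= t * fine (F p) + (1 - t) * fine (F q).
Proof.
move=> pF cF Fp Fq t0 t1; have := cF p q t Fp Fq t0 t1 => H.
rewrite -(fineK (edom_fin_num pF Fp)) -(fineK (edom_fin_num pF Fq)) in H.
rewrite -!EFinM -EFinD in H.
have Fpq : edom F (t *: p + (1 - t) *: q).
  by apply: le_lt_trans H _; exact: ltry.
by split=> //; rewrite -lee_fin fineK // edom_fin_num.
Qed.

(** Convexity on the segment from [q] to [p] bounds the increment at [q + t (p - q)] by
    [t (F p - F q)]; divide by [t] and let [t] tend to 0. The point [p] may lie on the boundary of
    the domain. *)
Lemma grad_ineq (R : realType) (d : nat) (F : 'rV[R]_d -> \bar R)
    (p q : 'rV[R]_d) : legendre F -> interior (edom F) q -> edom F p ->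
  fine (F q) + dotv (grad F q) (p - q) <= fine (F p).
Proof.
move=> [pF _ cF [dF _ _]] iq Fp; have Fq := interior_subset iq.
rewrite dotv_grad; last exact: dF.
rewrite -lerBrDl; apply: diff_le; first exact: dF.
near=> t; have t0 : 0 < t by near: t; exact: nbhs_right_gt.
have t1 : t < 1 by near: t; exact: nbhs_right_lt.
have [_] := convex_fine pF cF Fp Fq (ltW t0) (ltW t1).
have -> : t *: p + (1 - t) *: q = q + t *: (p - q).
  by apply/rowP => i; rewrite !mxE; ring.
by move=> H; lra.
Unshelve. all: by end_near. Qed.

(** A subgradient [g] bounds every directional derivative from below; the directions [v] and [- v]
    together force equality. *)
Lemma grad_unique (R : realType) (d : nat) (F : 'rV[R]_d -> \bar R)
    (q g : 'rV[R]_d) :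
  differentiable (fun p => fine (F p)) q -> interior (edom F) q ->
  (forall p, edom F p -> fine (F q) + dotv g (p - q) <= fine (F p)) ->
  grad F q = g.
Proof.
move=> dF iq H.
have le_g v : dotv g v <= dotv (grad F q) v.
  rewrite dotv_grad //; apply: diff_ge => //.
  near=> t; rewrite -dotvZr lerBrDl.
  have Ft : edom F (q + t *: v) by near: t; exact: near_right_segment.
  by have := H _ Ft; rewrite [q + _ - q]addrC addKr.
apply/rowP => i; rewrite -!dotv_delta; apply/le_anti; rewrite le_g andbT.
by rewrite -lerN2 -!dotvNr.
Unshelve. all: by end_near. Qed.

(** The map [s |-> 2 s - p] sends the midpoint to [q], hence points near the midpoint into the
    domain, and [s] is halfway between [p] and [2 s - p]. *)
Lemma interior_midpoint (R : realType) (d : nat) (F : 'rV[R]_d -> \bar R)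
    (p q : 'rV[R]_d) : proper_fun F -> convex_fun F ->
  edom F p -> interior (edom F) q ->
  interior (edom F) (2^-1 *: p + (1 - 2^-1) *: q).
Proof.
move=> pF cF Fp iq; pose m : 'rV[R]_d := 2^-1 *: p + (1 - 2^-1) *: q.
rewrite -/m; have h : (fun s : 'rV[R]_d => 2 *: s - p) @ m --> q.
  have -> : q = 2 *: m - p by apply/rowP => i; rewrite !mxE; field.
  apply: (@cvgB _ _ _ (nbhs m) _ ( *:%R 2) (fun=> p)); last exact: cvg_cst.
  exact: (@cvgZ _ _ _ (nbhs m) _ (fun=> 2) id 2 m (cvg_cst _) cvg_id).
have : \forall s \near m, edom F (2 *: s - p) by exact: h.
rewrite /interior /=; apply: filterS => s Fs.
have [Fs' _] := @convex_fine _ _ F p _ 2^-1 pF cF Fp Fs ltac:(lra) ltac:(lra).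
by move: Fs'; congr edom; apply/rowP => i; rewrite !mxE; field.
Qed.

(* Equality would make the affine minorant at [q] touch [F] at the midpoint too,
   contradicting the injectivity of the gradient. *)
Lemma grad_ineq_strict (R : realType) (d : nat) (F : 'rV[R]_d -> \bar R)
    (p q : 'rV[R]_d) : legendre F -> interior (edom F) q -> edom F p ->
  p != q -> fine (F q) + dotv (grad F q) (p - q) < fine (F p).
Proof.
move=> lF iq Fp pq; have := grad_ineq lF iq Fp.
rewrite le_eqVlt => /orP[/eqP E|//]; exfalso.
have [pF _ cF [dF iF _]] := lF.
pose m := 2^-1 *: p + (1 - 2^-1) *: q.
have im : interior (edom F) m by exact: interior_midpoint.
have [_ ubm] := @convex_fine _ _ F p q 2^-1 pF cF Fp (interior_subset iq)
  ltac:(lra) ltac:(lra).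
have mq : m - q = 2^-1 *: (p - q) by apply/rowP => i; rewrite !mxE; field.
have gm : grad F m = grad F q.
  apply: grad_unique => [||s Fs] //; first exact: dF.
  (* By [ubm] and [E], [F m <= F q + <grad F q, m - q>], so the minorant at [q] can be recentred at
     [m]. *)
  have := grad_ineq lF iq Fs.
  have -> : s - q = (s - m) + (m - q) by rewrite addrA subrK.
  rewrite dotvDr mq dotvZr -/m in ubm *; lra.
move: pq; rewrite -subr_eq0 => /negP; apply.
have /eqP := iF _ _ im iq gm.
by rewrite -subr_eq0 mq scaler_eq0 invr_eq0 pnatr_eq0.
Qed.

(** * Values of the Bregman divergence, including at boundary points *)

Lemma bregman_interior (R : realType) (d : nat) (F : 'rV[R]_d -> \bar R)
    (p q : 'rV[R]_d) : proper_fun F -> interior (edom F) q -> edom F p ->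
  bregman F p q
  = (fine (F p) - (fine (F q) + dotv (grad F q) (p - q)))%:E.
Proof.
move=> pF iq Fp; rewrite /bregman; case: asboolP => // _.
by rewrite -[F p]fineK ?edom_fin_num.
Qed.

Lemma bregman_infty (R : realType) (d : nat) (F : 'rV[R]_d -> \bar R)
    (p q : 'rV[R]_d) : F p = +oo%E -> bregman F p q = +oo%E.
Proof.
by move=> Fp; rewrite /bregman Fp eqxx addye //; case: asboolP.
Qed.

Lemma bregman_neNy (R : realType) (d : nat) (F : 'rV[R]_d -> \bar R)
    (p q : 'rV[R]_d) : proper_fun F -> edom F q -> bregman F p q != -oo%E.
Proof.
move=> pF Fq; have [Fp|] := eqVneq (F p) +oo%E; first by rewrite bregman_infty.
rewrite -ltey => Fp; rewrite /bregman; case: asboolP => [iq|_].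
  by rewrite -[F p]fineK ?edom_fin_num.
(* On the boundary branch only [dirder = +oo] could produce -oo; the quotient at [t = 1] rules it
   out. *)
have : (dirder F q (p - q)%R < +oo)%E.
  apply: (@le_lt_trans _ _ (F p - F q)%E).
    apply: ereal_inf_lbound; exists 1 => //=.
    by rewrite scale1r invr1 mule1 [q + _]addrC subrK.
  by rewrite -[F p]fineK ?edom_fin_num // -[F q]fineK ?edom_fin_num // ltry.
rewrite -[F p]fineK ?edom_fin_num // -[F q]fineK ?edom_fin_num //.
by case: (dirder F q _).
Qed.

(* [q] lies between [q - t q] and [2 q], so by convexity the difference
   quotients in [dirder F q (- q)] are bounded below by [F q - F (2 q)]. *)
Lemma bregman0_lty (R : realType) (d : nat) (F : 'rV[R]_d -> \bar R)
    (q : 'rV[R]_d) : proper_fun F -> convex_fun F ->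
  edom F 0 -> edom F q -> edom F (2 *: q) -> (bregman F 0 q < +oo)%E.
Proof.
move=> pF cF F0 Fq F2q; rewrite /bregman; case: asboolP => [iq|_].
  by rewrite -[F 0]fineK ?edom_fin_num ?ltry.
have : ((fine (F q) - fine (F (2 *: q)))%:E <= dirder F q (0 - q)%R)%E.
  apply: le_ereal_inf_tmp => _ [t /= t0 <-].
  have [Fy|] := eqVneq (F (q + t *: (0 - q))) +oo%E.
    rewrite Fy -[F q]fineK ?edom_fin_num // addye //.
    by rewrite gt0_mulye ?leey // lte_fin invr_gt0.
  rewrite -ltey => Fp.
  rewrite -[F (q + _)]fineK ?edom_fin_num // -[F q]fineK ?edom_fin_num //.
  rewrite -EFinB -EFinM lee_fin ler_pdivlMr //.
  (* The weights are [1 / (1 + t)] on [q - t q] and [t / (1 + t)] on [2 q]. *)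
  have t1 : 0 < 1 + t by lra.
  have c0 : 0 <= (1 + t)^-1 by rewrite invr_ge0 ltW.
  have c1 : (1 + t)^-1 <= 1 by rewrite invf_le1 //; lra.
  have [_] := convex_fine pF cF Fp F2q c0 c1.
  have -> : (1 + t)^-1 *: (q + t *: (0 - q)) + (1 - (1 + t)^-1) *: (2 *: q) = q.
    by apply/rowP => i; rewrite !mxE; field; lra.
  have -> : 1 - (1 + t)^-1 = (1 + t)^-1 * t by field; lra.
  by rewrite -mulrA -mulrDr ler_pdivlMl // => H; lra.
rewrite -[F 0]fineK ?edom_fin_num // -[F q]fineK ?edom_fin_num //.
by case: (dirder F q _) => // r _; exact: ltry.
Qed.

(** * Bilinear forms and positive definiteness *)

Definition bilin (R : realType) (d : nat) (A : 'M[R]_d) (u v : 'rV[R]_d) : R :=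
  (u *m A *m v^T) 0 0.

Lemma bilinDl (R : realType) (d : nat) (A : 'M[R]_d) (u v w : 'rV[R]_d) :
  bilin A (u + v) w = bilin A u w + bilin A v w.
Proof. by rewrite /bilin !mulmxDl mxE. Qed.

Lemma bilinDr (R : realType) (d : nat) (A : 'M[R]_d) (u v w : 'rV[R]_d) :
  bilin A u (v + w) = bilin A u v + bilin A u w.
Proof. by rewrite /bilin linearD mulmxDr mxE. Qed.

Lemma bilinZr (R : realType) (d : nat) (A : 'M[R]_d) (a : R) (u v : 'rV[R]_d) :
  bilin A u (a *: v) = a * bilin A u v.
Proof. by rewrite /bilin linearZ -scalemxAr mxE. Qed.

Lemma bilin0r (R : realType) (d : nat) (A : 'M[R]_d) (u : 'rV[R]_d) :
  bilin A u 0 = 0.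
Proof. by rewrite -(scale0r 0) bilinZr mul0r. Qed.

Lemma bilinC (R : realType) (d : nat) (A : 'M[R]_d) (u v : 'rV[R]_d) :
  A^T = A -> bilin A u v = bilin A v u.
Proof.
move=> AT; have E : u *m A *m v^T = (v *m A *m u^T)^T.
  by rewrite !trmx_mul trmxK AT mulmxA.
by rewrite /bilin E mxE.
Qed.

Lemma dotv_mulmxD (R : realType) (d : nat) (A : 'M[R]_d) (b u v : 'rV[R]_d) :
  dotv (u *m A + b) v = bilin A u v + dotv b v.
Proof.
rewrite /bilin mxE /dotv -big_split; apply: eq_bigr => i _.
by rewrite !mxE mulrDl.
Qed.

(** Exact second-order Taylor expansion at [q], with gradient [q A + b]; symmetry of [A] merges the
    two cross terms. *)
Lemma quadratic_expansion (R : realType) (d : nat) (A : 'M[R]_d)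
    (b p q : 'rV[R]_d) : A^T = A ->
  2^-1 * bilin A p p + dotv b p =
  2^-1 * bilin A q q + dotv b q + dotv (q *m A + b) (p - q)
  + 2^-1 * bilin A (p - q) (p - q).
Proof.
move=> AT; have [v ->] : exists v, p = q + v.
  by exists (p - q); rewrite addrC subrK.
rewrite [q + v - q]addrC addKr dotv_mulmxD bilinDl !bilinDr dotvDr.
by rewrite (bilinC v q AT); field.
Qed.

Lemma posdef_unitmx (R : realType) (d : nat) (A : 'M[R]_d) :
  (forall v, v != 0 -> 0 < bilin A v v) -> A \in unitmx.
Proof.
move=> Apos; rewrite -row_free_unit -kermx_eq0; apply/rowV0P.
move=> v /sub_kermxP vA.
apply/eqP/negPn/negP => /Apos.
by rewrite /bilin vA mul0mx mxE ltxx.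
Qed.

Lemma posdef_ge0 (R : realType) (d : nat) (A : 'M[R]_d) (v : 'rV[R]_d) :
  (forall v, v != 0 -> 0 < bilin A v v) -> 0 <= bilin A v v.
Proof.
by move=> Apos; have [->|/Apos/ltW//] := eqVneq v 0; rewrite bilin0r.
Qed.

(** * The quadratic case *)

Section Quadratic.
Context (R : realType) (d : nat) (F : 'rV[R]_d -> \bar R).
Context (A : 'M[R]_d) (b : 'rV[R]_d).
Hypotheses (lF : legendre F) (AT : A^T = A).
Hypothesis (Apos : forall v, v != 0 -> 0 < bilin A v v).
Hypothesis (FE : forall p, edom F p ->
  F p = (2^-1 * bilin A p p + dotv b p)%:E).

(** Stated for the polynomial rather than for [F], so that it holds at all points before the domain
    is known. *)
Lemma quadratic_subgradient (p q : 'rV[R]_d) :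
  2^-1 * bilin A q q + dotv b q + dotv (q *m A + b) (p - q)
  <= 2^-1 * bilin A p p + dotv b p.
Proof.
rewrite (quadratic_expansion b p q AT) lerDl.
by rewrite mulr_ge0 ?posdef_ge0 // invr_ge0.
Qed.

Lemma quadratic_conjugate_lty (y : 'rV[R]_d) : (conjugate F y < +oo)%E.
Proof.
(* At [c] the polynomial has gradient [y], so [c] maximizes [<y, p>] minus the polynomial. *)
pose c := (y - b) *m invmx A.
have cA : c *m A + b = y by rewrite mulmxKV ?posdef_unitmx // subrK.
apply: (@le_lt_trans _ _ (dotv y c - (2^-1 * bilin A c c + dotv b c))%:E);
  last exact: ltry.
apply: ge_ereal_sup => _ [p _ <-].
have [->|] := eqVneq (F p) +oo%E; first by rewrite addeNy leNye.
rewrite -ltey => Fp; rewrite FE // -EFinB lee_fin.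
have := quadratic_subgradient p c; rewrite cA dotvDr dotvNr; lra.
Qed.

(** The vector [c A + b] lies in the interior of the conjugate's domain, so it is the gradient
    [q A + b] at some interior [q]; invertibility of [A] gives [q = c]. *)
Lemma quadratic_interior (c : 'rV[R]_d) : interior (edom F) c.
Proof.
have [_ _ _ [dF _ surj]] := lF.
have : interior (edom (conjugate F)) (c *m A + b).
  have -> : edom (conjugate F) = setT.
    by apply/seteqP; split => // y _; exact: quadratic_conjugate_lty.
  by rewrite interiorT.
rewrite -surj => -[q iq]; have Fq := interior_subset iq.
rewrite (@grad_unique _ _ _ _ (q *m A + b)) //; first last.
- by move=> p Fp; rewrite !FE //=; exact: quadratic_subgradient.
- exact: dF.
move/addIr/(congr1 (mulmx^~ (invmx A))).
by rewrite !mulmxK ?posdef_unitmx // => <-.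
Qed.

Lemma quadratic_bregman (p q : 'rV[R]_d) :
  bregman F p q = (2^-1 * bilin A (p - q) (p - q))%:E.
Proof.
have iF c : interior (edom F) c by exact: quadratic_interior.
have Fc c : edom F c by exact: interior_subset (iF c).
have [pF _ _ [dF _ _]] := lF.
rewrite bregman_interior // (@grad_unique _ _ _ _ (q *m A + b)) //.
- by rewrite !FE //= (quadratic_expansion b p q AT) addrAC subrr add0r.
- exact: dF.
- by move=> s Fs; rewrite !FE //=; exact: quadratic_subgradient.
Qed.

Lemma quadratic_exp_bregman (X : finType) (D : X -> R)
    (pi pi0 : X -> 'rV[R]_d) :
  exp_bregman D F pi pi0 =
  (2^-1 * \sum_x D x * bilin A (pi x - pi0 x) (pi x - pi0 x))%:E.
Proof.
rewrite /exp_bregman big_distrr -sumEFin; apply: eq_bigr => x _.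
by rewrite quadratic_bregman -EFinM mulrCA.
Qed.

(** A Pythagorean argument: the error [e] is constant on orbits of [Phi], while the residual [r] has
    weighted sum 0 over each orbit, so the two are orthogonal. At a fixed point of [Phi] the formula
    reduces to [pi0 x]. *)
Lemma quadratic_minimizer (X : finType) (D : X -> R) (Phi : X -> X)
    (pi0 pibar : X -> 'rV[R]_d) :
  (forall x, 0 < D x) -> (forall x, Phi (Phi x) = x) ->
  coherent Phi pibar ->
  (forall pi, coherent Phi pi ->
     (exp_bregman D F pibar pi0 <= exp_bregman D F pi pi0)%E) ->
  forall x, pibar x = (D x + D (Phi x))^-1 *:
                      (D x *: pi0 x + D (Phi x) *: pi0 (Phi x)).
Proof.
move=> D0 PhiK cbar minbar.
pose avg x := (D x + D (Phi x))^-1 *: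
                (D x *: pi0 x + D (Phi x) *: pi0 (Phi x)).
have cavg : coherent Phi avg.
  by move=> x; rewrite /avg PhiK [D (Phi x) + _]addrC [D (Phi x) *: _ + _]addrC.
pose e x := pibar x - avg x.
pose r x := avg x - pi0 x.
have r0 x : D x *: r x + D (Phi x) *: r (Phi x) = 0.
  rewrite /r -cavg; have := D0 x; have := D0 (Phi x) => h1 h2.
  by apply/rowP => i; rewrite !mxE; field; lra.
have cross : \sum_x D x * bilin A (e x) (r x) = 0.
  pose S := \sum_x D x * bilin A (e x) (r x).
  (* Reindexing by [Phi] pairs [x] with [Phi x], and [S + S] then has the vanishing sum [r0] in each
     term. *)
  have SPhi : S = \sum_x D (Phi x) * bilin A (e x) (r (Phi x)).
    rewrite /S (reindex_inj (inv_inj PhiK)); apply: eq_bigr => x _.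
    by rewrite /e -cbar -cavg.
  have : S + S = 0.
    rewrite {2}SPhi -big_split big1 // => x _ /=.
    by rewrite -!bilinZr -bilinDr r0 bilin0r.
  by rewrite /S => h; lra.
have := minbar _ cavg; rewrite !quadratic_exp_bregman lee_fin.
rewrite ler_pM2l ?invr_gt0 // -subr_le0 -sumrB.
have -> : \sum_x (D x * bilin A (pibar x - pi0 x) (pibar x - pi0 x)
            - D x * bilin A (avg x - pi0 x) (avg x - pi0 x))
        = \sum_x D x * bilin A (e x) (e x)
          + 2 * \sum_x D x * bilin A (e x) (r x).
  rewrite big_distrr -big_split; apply: eq_bigr => x _.
  have -> : pibar x - pi0 x = e x + r x by rewrite /e /r addrA subrK.
  rewrite -/(r x) bilinDl !(@bilinDr _ _ A _ (e x) (r x)).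
  by rewrite (bilinC (r x) (e x) AT) /=; ring.
(* What remains is a sum of nonnegative terms that is at most 0, so every [e x] vanishes. *)
rewrite cross mulr0 addr0 => le0 x.
have ge0 y : 0 <= D y * bilin A (e y) (e y).
  by rewrite mulr_ge0 ?posdef_ge0 // ltW.
have /psumr_eq0P eq0 : \sum_x D x * bilin A (e x) (e x) = 0.
  by apply/le_anti; rewrite le0 sumr_ge0.
apply/eqP; rewrite -subr_eq0; apply/negPn/negP => /Apos.
have /eqP := eq0 (fun y _ => ge0 y) x isT.
by rewrite mulf_eq0 gt_eqF //= => /eqP ->; rewrite ltxx.
Qed.

End Quadratic.

(** * Finiteness of the objective *)

Lemma exp_bregman_lty_edom (R : realType) (d : nat) (X : finType) (D : X -> R)
    (F : 'rV[R]_d -> \bar R) (pi pi0 : X -> 'rV[R]_d) :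
  proper_fun F -> (forall x, 0 < D x) -> (forall x, edom F (pi0 x)) ->
  (exp_bregman D F pi pi0 < +oo)%E -> forall x, edom F (pi x).
Proof.
move=> pF D0 F0 fin x; rewrite /edom /= ltey; apply/eqP => Fx.
suff E : exp_bregman D F pi pi0 = +oo%E by rewrite E ltxx in fin.
apply/esum_eqyP => [y _|]; last first.
  exists x; split=> //.
  (* Positivity of [D x] matters: [0 * +oo] is 0. *)
  by rewrite bregman_infty // gt0_muley // lte_fin.
have := bregman_neNy (pi y) pF (F0 y); have := D0 y.
case: (bregman F (pi y) (pi0 y)) => // Dy _.
by rewrite gt0_muley // lte_fin.
Qed.

(** The orthant is closed under doubling, which supplies the point [2 q] needed by
    [bregman0_lty]. *)
Lemma exp_bregman0_lty (R : realType) (d : nat) (X : finType) (D : X -> R)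
    (F : 'rV[R]_d -> \bar R) (pi0 : X -> 'rV[R]_d) :
  proper_fun F -> convex_fun F -> (forall x, 0 < D x) ->
  (forall p : 'rV[R]_d, (forall i, 0 <= p 0 i) -> edom F p) ->
  (forall x i, 0 <= pi0 x 0 i) ->
  (exp_bregman D F (fun=> 0%R) pi0 < +oo)%E.
Proof.
move=> pF cF D0 orth pi00; apply: lte_sum_pinfty => x _.
have : (bregman F 0%R (pi0 x) < +oo)%E.
  apply: bregman0_lty => //; apply: orth => i; rewrite ?mxE //.
  by rewrite mulr_ge0.
have := bregman_neNy 0 pF (orth _ (pi00 x)).
by case: (bregman F 0%R (pi0 x)) => // r _ _; rewrite -EFinM ltry.
Qed.

(** * The separable case: positive parts and monotone partial derivatives *)

Lemma subgradient_mono (R : realFieldType) (x y fx fy gx gy : R) :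
  x < y -> fx + gx * (y - x) <= fy -> fy + gy * (x - y) <= fx -> gx <= gy.
Proof.
rewrite -subr_gt0 => yx hx hy.
by rewrite -(ler_pM2r yx); lra.
Qed.

Definition pos_part (R : realType) (d : nat) (p : 'rV[R]_d) : 'rV[R]_d :=
  \row_i Num.max 0 (p 0 i).

Lemma pos_part_ge0 (R : realType) (d : nat) (p : 'rV[R]_d) (i : 'I_d) :
  0 <= pos_part p 0 i.
Proof. by rewrite mxE le_max lexx. Qed.

(** The vector [p - pos_part p] lives on the negative coordinates of [p], where its entries are
    negative and [pos_part p] is 0, hence below [q]; the sign reverses [g <= h]. *)
Lemma dotv_sub_pos_part (R : realType) (d : nat) (g h p q : 'rV[R]_d) :
  (forall i, 0 <= q 0 i) ->
  (forall i, pos_part p 0 i <= q 0 i -> g 0 i <= h 0 i) ->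
  dotv h (p - pos_part p) <= dotv g (p - pos_part p).
Proof.
move=> q0 gh; apply: ler_sum => i _; have := gh i; rewrite !mxE.
have [pi0 _|pi0 /(_ (q0 i)) ghi] := leP 0 (p 0 i).
  by rewrite subrr !mulr0.
by rewrite subr0 ler_nM2r.
Qed.

Section Separable.
Context (R : realType) (d : nat) (F : 'rV[R]_d -> \bar R) (f : R -> \bar R).
Hypotheses (lF : legendre F) (cf : convex_fun1 f).
Hypothesis (FE : forall p, F p = (\sum_(i < d) f (p ord0 i))%E).
Hypothesis (orthF : forall p : 'rV[R]_d, (forall i, 0 <= p 0 i) -> edom F p).

(** The index [i] witnesses [d > 0]; for [d = 0] the sum is empty and says nothing about [f]. *)
Lemma separable_neNy (i : 'I_d) (a : R) : f a != -oo%E.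
Proof.
have [[FN _] _ _ _] := lF; apply: contra (FN (const_mx a)) => /eqP fa.
apply/eqP; rewrite FE; apply/esum_eqNyP; exists i; split => //.
by rewrite mxE.
Qed.

Lemma separable_edomP (p : 'rV[R]_d) :
  edom F p <-> forall i, (f (p 0%R i) < +oo)%E.
Proof.
rewrite /edom /= FE; split=> [+ i|fp]; last exact: lte_sum_pinfty.
rewrite !ltey; apply: contra => /eqP fp; apply/eqP/esum_eqyP.
  by move=> j _; exact: separable_neNy.
by exists i.
Qed.

Lemma separable_fine (p : 'rV[R]_d) : edom F p ->
  fine (F p) = \sum_(i < d) fine (f (p 0 i)).
Proof.
move=> /separable_edomP fp; rewrite FE sum_fine // => i _.
by rewrite fin_numE separable_neNy // lt_eqF.
Qed.

(** Moving only coordinate [i] of [u] cancels all other terms of the gradient inequality, so the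
    partial derivative is a subgradient of [f] at [u 0 i]. *)
Lemma separable_partial_ineq (u : 'rV[R]_d) (i : 'I_d) (a : R) :
  interior (edom F) u -> (f a < +oo)%E ->
  fine (f (u 0 i)) + grad F u 0 i * (a - u 0 i) <= fine (f a).
Proof.
move=> iu fa; have Fu := interior_subset iu.
pose w := u + (a - u 0 i) *: delta_mx 0 i.
have wi : w 0 i = a by rewrite !mxE !eqxx mulr1 addrC subrK.
have wj j : j != i -> w 0 j = u 0 j.
  by move=> ji; rewrite !mxE (negbTE ji) andbF mulr0 addr0.
have Fw : edom F w.
  apply/separable_edomP => j; have [->|ji] := eqVneq j i; first by rewrite wi.
  by rewrite wj //; move/separable_edomP: Fu.
have := grad_ineq lF iu Fw.
rewrite !separable_fine // (bigD1 i) //= [X in _ <= X](bigD1 i) //= wi.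
rewrite [X in _ <= _ + X](eq_bigr (fun j => fine (f (u 0 j)))); last first.
  by move=> j /wj ->.
rewrite /w [u + _ - u]addrC addKr dotvZr dotv_delta; lra.
Qed.

Lemma separable_grad_mono (u q : 'rV[R]_d) (i : 'I_d) :
  interior (edom F) u -> interior (edom F) q -> u 0 i <= q 0 i ->
  grad F u 0 i <= grad F q 0 i.
Proof.
move=> iu iq; rewrite le_eqVlt => /orP[/eqP uq|uq]; last first.
  have /separable_edomP/(_ i) fu := interior_subset iu.
  have /separable_edomP/(_ i) fq := interior_subset iq.
  exact: subgradient_mono uq (separable_partial_ineq i iu fq)
                             (separable_partial_ineq i iq fu).
(* Equal coordinates: [u] and [q] may differ elsewhere. The partial derivative at [u] is a
   subgradient of [f] at the common value, so it bounds the increments of [F] at [q] in direction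
   [i] from below. *)
have [_ _ _ [dF _ _]] := lF.
have := @dotv_grad _ _ F q (delta_mx 0 i) (dF q iq).
rewrite dotv_delta => gq; rewrite [leRHS]gq; apply: diff_ge; first exact: dF.
near=> t.
have : edom F (q + t *: delta_mx 0 i) by near: t; exact: near_right_segment.
set w := q + _ => Fw.
have wi : w 0 i = u 0 i + t by rewrite !mxE !eqxx mulr1 uq.
have wj j : j != i -> w 0 j = q 0 j.
  by move=> ji; rewrite !mxE (negbTE ji) andbF mulr0 addr0.
have /separable_edomP/(_ i) := Fw; rewrite wi => /(separable_partial_ineq i iu).
rewrite [u 0 i + t - u 0 i]addrC addKr -lerBrDl [_ * t]mulrC.
move=> /le_trans; apply.
rewrite !separable_fine //; last exact: interior_subset.
rewrite (bigD1 i) //= [X in _ <= _ - X](bigD1 i) //= wi -uq.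
rewrite [X in _ <= _ + X - _](eq_bigr (fun j => fine (f (q 0 j)))); last first.
  by move=> j /wj ->.
by rewrite opprD addrACA subrr addr0.
Unshelve. all: by end_near. Qed.

(** Convexity between [a] and 0 makes [f] finite on all of [(a, +oo)], and the finitely many
    conditions [a < p 0 i] are open. *)
Lemma separable_nonneg_interior (a : R) (q : 'rV[R]_d) :
  a < 0 -> (f a < +oo)%E -> (forall i, 0 <= q 0 i) -> interior (edom F) q.
Proof.
move=> a0 fa q0.
have fin (i : 'I_d) b : a < b -> (f b < +oo)%E.
  have f_nonneg c : 0 <= c -> (f c < +oo)%E.
    move=> c0; have /separable_edomP/(_ i) : edom F (const_mx c).
      by apply: orthF => j; rewrite mxE.
    by rewrite mxE.
  move=> ab; have [/f_nonneg//|b0] := leP 0 b.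
  (* Here [b] is the combination of [a] and 0 with weight [b / a] on [a]. *)
  have t0 : 0 <= b / a by rewrite ler_ndivlMr //; lra.
  have t1 : b / a <= 1 by rewrite ler_ndivrMr //; lra.
  have := cf fa (f_nonneg 0 (lexx _)) t0 t1.
  rewrite mulr0 addr0 divfK ?lt_eqF // => /le_lt_trans; apply.
  have fN := @separable_neNy i; have f0 := f_nonneg 0 (lexx _).
  rewrite -[f a]fineK ?fin_numE ?fN ?lt_eqF //.
  by rewrite -[f 0]fineK ?fin_numE ?fN ?lt_eqF // -!EFinM -EFinD ltry.
have : \forall p \near q, forall i : 'I_d, a < (p : 'rV[R]_d) 0 i.
  apply: (@filter_forall _ _ (fun i (p : 'rV[R]_d) => a < p 0 i)
    _ (nbhs_filter q)) => i.
  have : (fun p : 'rV[R]_d => p 0 i) @ q --> q 0 i.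
    exact: differentiable_continuous (differentiable_coord _ _ _).
  by move=> /cvgr_gt; apply; apply: lt_le_trans a0 (q0 i).
by apply: filterS => p ap; apply/separable_edomP => i; exact: fin.
Qed.

Lemma separable_bregman_pos_part (a : R) (p q : 'rV[R]_d) :
  a < 0 -> (f a < +oo)%E -> (forall i, 0 <= q 0 i) -> edom F p ->
  p != pos_part p -> (bregman F (pos_part p) q < bregman F p q)%E.
Proof.
(* To be used with [g = <grad F r, p - r>], [h = <grad F q, p - r>] and [k = <grad F q, r - q>]. *)
have gap (Fr Fp Fq g h k : R) : Fr + g < Fp -> h <= g ->
  Fr - (Fq + k) < Fp - (Fq + (h + k)) by move=> *; lra.
move=> a0 fa q0 Fp pp; set r := pos_part p.
have r0 i : 0 <= r 0 i by exact: pos_part_ge0.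
have ir : interior (edom F) r by exact: separable_nonneg_interior fa r0.
have iq : interior (edom F) q by exact: separable_nonneg_interior fa q0.
have [pF _ _ _] := lF.
rewrite !bregman_interior //; last exact: orthF.
have E : dotv (grad F q) (p - q)
    = dotv (grad F q) (p - r) + dotv (grad F q) (r - q).
  by rewrite -dotvDr addrA subrK.
rewrite lte_fin E; apply: gap (grad_ineq_strict lF ir Fp pp) _.
apply: dotv_sub_pos_part q0 _ => i; exact: separable_grad_mono.
Qed.

Lemma separable_minimizer_ge0 (X : finType) (D : X -> R) (Phi : X -> X)
    (pi0 pibar : X -> 'rV[R]_d) :
  (forall x, 0 < D x) -> (forall x i, 0 <= pi0 x 0 i) ->
  coherent Phi pibar ->
  (forall pi, coherent Phi pi ->
     (exp_bregman D F pibar pi0 <= exp_bregman D F pi pi0)%E) ->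
  forall x i, 0 <= pibar x 0 i.
Proof.
move=> D0 pi00 cbar minbar.
have [pF _ cF _] := lF.
have Fpi0 x : edom F (pi0 x) by exact: orthF.
have Fbar : forall x, edom F (pibar x).
  apply: (exp_bregman_lty_edom pF D0 Fpi0).
  apply: (@le_lt_trans _ _ (exp_bregman D F (fun=> 0%R) pi0)).
    by apply: minbar.
  exact: exp_bregman0_lty.
move=> x i; rewrite leNgt; apply/negP => neg.
have fa : (f (pibar x 0%R i) < +oo)%E by have /separable_edomP := Fbar x; apply.
(* The negative entry of [pibar x] serves as [a]: every [pi0 y] is interior, so all divergences
   compared below are real numbers. *)
have interior_ge0 := separable_nonneg_interior neg fa.
have xpos : pibar x != pos_part (pibar x).
  by apply/eqP => E; rewrite E ltNge pos_part_ge0 in neg.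
pose B p y := fine (bregman F p (pi0 y)).
have BE p y : edom F p -> bregman F p (pi0 y) = (B p y)%:E.
  by move=> Fp; rewrite /B bregman_interior //; exact: interior_ge0.
have expE pi : (forall y, edom F (pi y)) ->
    exp_bregman D F pi pi0 = (\sum_y D y * B (pi y) y)%:E.
  by move=> Fpi; rewrite -sumEFin; apply: eq_bigr => y _; rewrite BE.
have Fpos y : edom F (pos_part (pibar y)) by exact: orthF (pos_part_ge0 _).
have B_lt y : pibar y != pos_part (pibar y) ->
    B (pos_part (pibar y)) y < B (pibar y) y.
  move=> ne; rewrite -lte_fin -!BE //.
  exact: separable_bregman_pos_part neg fa _ _ _.
have cpos : coherent Phi (fun y => pos_part (pibar y)).
  by move=> y; rewrite -cbar.
have := minbar _ cpos; rewrite !expE // lee_fin leNgt => /negP; apply.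
(* The decrease is strict at [x] and weak at every other point. *)
rewrite (bigD1 x) //= [X in _ < X](bigD1 x) //=; apply: ltr_leD.
  by rewrite ltr_pM2l ?B_lt.
apply: ler_sum => y _; rewrite ler_pM2l //.
by have [<-|/B_lt/ltW] := eqVneq (pibar y) (pos_part (pibar y)).
Qed.

End Separable.

Theorem theorem11 (R : realType) (d : nat) (X : finType)
    (D : X -> R) (Phi : X -> X) (pi0 : X -> 'rV[R]_d)
    (F : 'rV[R]_d -> \bar R) (pibar : X -> 'rV[R]_d) :
  (forall x, 0 < D x) -> \sum_(x : X) D x = 1 ->
  (forall x, Phi (Phi x) = x) ->
  (forall x i, 0 <= pi0 x 0 i) -> (forall x, \sum_(i < d) pi0 x 0 i = 1) ->
  legendre F ->
  closed (edom F) ->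
  (forall p : 'rV[R]_d, (forall i, 0 <= p 0 i) -> edom F p) ->
  quadratic_fun F \/ separable_fun F ->
  coherent Phi pibar ->
  (forall pi, coherent Phi pi ->
     (exp_bregman D F pibar pi0 <= exp_bregman D F pi pi0)%E) ->
  coherent Phi pibar /\ (forall x i, 0 <= pibar x 0 i).
Proof.
move=> D0 _ PhiK pi00 _ lF _ orthF qs cbar minbar; split=> //.
case: qs => [[A [b [AT Apos FE]]]|[f [cf FE]]].
  move=> x i; rewrite (quadratic_minimizer lF AT Apos FE D0 PhiK cbar minbar).
  rewrite !mxE mulr_ge0 ?invr_ge0 ?addr_ge0 ?mulr_ge0 ?(ltW (D0 _)) //.
exact: (separable_minimizer_ge0 lF cf FE orthF D0 pi00 cbar minbar).
Qed.
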